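(* Let $(C,\psi_C)$ be a Coder pair with comultiplication $\Delta$, and let $(\Delta_t,\psi_t)$, with $\Delta_t=\sum_{i\ge 0}\Delta_i t^i$ and $\psi_t=\sum_{i\ge 0}\psi_i t^i$, be a 1-parameter formal deformation of $(C,\psi_C)$. Then $(\Delta_1,\psi_1)\in C^2_{\mathrm{Coder}}(C,C)$ is a $2$-cocycle in the cochain complex of the Coder pair $(C,\psi_C)$ with coefficients in itself, i.e. $d_c^2(\Delta_1,\psi_1)=0$. Moreover, for every integer $m\ge 1$, if $(\Delta_i,\psi_i)=0$ for all $1\le i\le m$, then $(\Delta_{m+1},\psi_{m+1})$ is a $2$-cocycle in $C^2_{\mathrm{Coder}}(C,C)$.
   Context: Everything is over a field $\mathbb{F}$ of characteristic $0$ (vector spaces, linear maps, $\otimes$, $\mathrm{Hom}$). A coassociative coalgebra is a pair $(C,\Delta)$ with $C$ a vector space and $\Delta:C\to C\otimes C$ linear such that $(\mathrm{Id}_C\otimes\Delta)\circ\Delta=(\Delta\otimes\mathrm{Id}_C)\circ\Delta$. A coderivation of $C$ is a linear map $\psi_C:C\to C$ with $\Delta\circ\psi_C=(\psi_C\otimes\mathrm{Id}_C)\circ\Delta+(\mathrm{Id}_C\otimes\psi_C)\circ\Delta$. A Coder pair $(C,\psi_C)$ is a coassociative coalgebra $C$ with a coderivation $\psi_C$. Cochain complex of $(C,\psi_C)$ with coefficients in itself (the coadjoint bicomodule): for $n\ge 0$ let $C_c^n(C,C)=\mathrm{Hom}(C,C^{\otimes n})$ and, for $f\in C_c^n(C,C)$,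 $$\delta_c(f)=(\mathrm{Id}_C\otimes f)\circ\Delta+\sum_{i=1}^n(-1)^i(\mathrm{Id}_{C^{\otimes(i-1)}}\otimes\Delta\otimes\mathrm{Id}_{C^{\otimes(n-i)}})\circ f+(-1)^{n+1}(f\otimes\mathrm{Id}_C)\circ\Delta\in C_c^{n+1}(C,C).$$ For $n\ge1$ let $\omega:C_c^n(C,C)\to C_c^n(C,C)$, $\omega(f)=\sum_{i=1}^n(\mathrm{Id}_{C^{\otimes(i-1)}}\otimes\psi_C\otimes\mathrm{Id}_{C^{\otimes(n-i)}})\circ f-f\circ\psi_C$. Set $C^0_{\mathrm{Coder}}(C,C)=0$, $C^1_{\mathrm{Coder}}(C,C)=\mathrm{Hom}(C,C)$, and $C^n_{\mathrm{Coder}}(C,C)=C_c^n(C,C)\times C_c^{n-1}(C,C)$ for $n\ge2$, with differential $d_c^1(f)=(\delta_c(f),-\omega(f))$ and $d_c^n(f,g)=(\delta_c(f),\delta_c(g)+(-1)^n\omega(f))$ for $n\ge2$. An $n$-cocycle is an element of $\ker d_c^n$. A 1-parameter formal deformation of $(C,\psi_C)$ is a pair $(\Delta_t,\psi_t)$ of formal power series $\Delta_t=\sum_{i\ge0}\Delta_it^i$, $\psi_t=\sum_{i\ge0}\psi_it^i$ with $\Delta_i\in\mathrm{Hom}(C,C^{\otimes2})$, $\psi_i\in\mathrm{Hom}(C,C)$, $\Delta_0=\Delta$, $\psi_0=\psi_C$, satisfying $(\mathrm{Id}_C\otimes\Delta_t)\circ\Delta_t=(\Delta_t\otimes\mathrm{Id}_C)\circ\Delta_t$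 and $\Delta_t\circ\psi_t=(\psi_t\otimes\mathrm{Id}_C)\circ\Delta_t+(\mathrm{Id}_C\otimes\psi_t)\circ\Delta_t$; equivalently, for all $k\ge0$, $\sum_{i+j=k}\big((\mathrm{Id}_C\otimes\Delta_i)\circ\Delta_j-(\Delta_i\otimes\mathrm{Id}_C)\circ\Delta_j\big)=0$ and $\sum_{i+j=k}\big(\Delta_i\circ\psi_j-(\psi_i\otimes\mathrm{Id}_C)\circ\Delta_j-(\mathrm{Id}_C\otimes\psi_i)\circ\Delta_j\big)=0$ (sums over $i,j\ge0$). *)

(* Defs.v *)
From HB Require Import structures.
From mathcomp Require Import all_boot all_order all_algebra.
From mathcomp Require Import sesquilinear.
From mathcomp Require Import boolp.
From mathcomp.multinomials Require Import freeg.

Set Implicit Arguments.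
Unset Strict Implicit.
Unset Printing Implicit Defensive.

Import GRing.Theory.
Local Open Scope ring_scope.
Local Open Scope quotient_scope.

Section LinearMaps.
Variables (F : fieldType) (U V W : lmodType F).

HB.instance Definition _ := gen_eqMixin {linear U -> V}.
HB.instance Definition _ := gen_choiceMixin {linear U -> V}.

Lemma linear_eqP (f g : {linear U -> V}) : f =1 g -> f = g.
Proof.
case: f g => [f [[f0] [f1]]] [g [[g0] [g1]]] /= /funext fg.
rewrite {}fg in f0 f1 *.
by rewrite (Prop_irrelevance f0 g0) (Prop_irrelevance f1 g1).
Qed.

Definition lzero : {linear U -> V} := \0.
Definition ladd (f g : {linear U -> V}) : {linear U -> V} := f \+ g.
Definition lopp (f : {linear U -> V}) : {linear U -> V} := \- f.
Definition lscale (a : F) (f : {linear U -> V}) : {linear U -> V} := a \*: f.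

Fact laddA : associative ladd.
Proof. by move=> f g h; apply: linear_eqP => x /=; rewrite addrA. Qed.
Fact laddC : commutative ladd.
Proof. by move=> f g; apply: linear_eqP => x /=; rewrite addrC. Qed.
Fact ladd0 : left_id lzero ladd.
Proof. by move=> f; apply: linear_eqP => x /=; rewrite add0r. Qed.
Fact laddN : left_inverse lzero lopp ladd.
Proof. by move=> f; apply: linear_eqP => x /=; rewrite addNr. Qed.

HB.instance Definition _ :=
  GRing.isZmodule.Build {linear U -> V} laddA laddC ladd0 laddN.

Fact lscaleA a b f : lscale a (lscale b f) = lscale (a * b) f.
Proof. by apply: linear_eqP => x /=; rewrite scalerA. Qed.
Fact lscale1 : left_id 1 lscale.
Proof. by move=> f; apply: linear_eqP => x /=; rewrite scale1r. Qed.
Fact lscaleDr : right_distributive lscale +%R.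
Proof. by move=> a f g; apply: linear_eqP => x /=; rewrite scalerDr. Qed.
Fact lscaleDl f : {morph lscale^~ f : a b / a + b}.
Proof. by move=> a b; apply: linear_eqP => x /=; rewrite scalerDl. Qed.

HB.instance Definition _ := GRing.Zmodule_isLmodule.Build F {linear U -> V}
  lscaleA lscale1 lscaleDr lscaleDl.

Definition lcomp (g : {linear V -> W}) (f : {linear U -> V}) :
  {linear U -> W} := g \o f.

End LinearMaps.

Definition lid (F : fieldType) (U : lmodType F) : {linear U -> U} := idfun.

Notation "g \oL f" := (lcomp g f) (at level 40, left associativity).

Section Tensor.
Variables (F : fieldType) (U V : lmodType F).

Let free := {freeg (U * V)%type / F}.
Let gen (u : U) (v : V) : free := [freeg [:: (1, (u, v))]].

Inductive tensor_rel : free -> Prop :=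
| TensorRel0 : tensor_rel 0
| TensorRelD x y : tensor_rel x -> tensor_rel y -> tensor_rel (x + y)
| TensorRelZ a x : tensor_rel x -> tensor_rel (a *: x)
| TensorRelDl u u' v : tensor_rel (gen (u + u') v - gen u v - gen u' v)
| TensorRelDr u v v' : tensor_rel (gen u (v + v') - gen u v - gen u v')
| TensorRelZl a u v : tensor_rel (gen (a *: u) v - a *: gen u v)
| TensorRelZr a u v : tensor_rel (gen u (a *: v) - a *: gen u v).

Definition tensor_equiv (x y : free) : bool := `[< tensor_rel (x - y) >].

Let tensor_relN x : tensor_rel x -> tensor_rel (- x).
Proof. by move=> xR; rewrite -scaleN1r; apply: TensorRelZ. Qed.

Fact tensor_equiv_refl : reflexive tensor_equiv.
Proof. by move=> x; apply/asboolP; rewrite subrr; apply: TensorRel0. Qed.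
Fact tensor_equiv_sym : symmetric tensor_equiv.
Proof.
by move=> x y; apply/asboolP/asboolP => /tensor_relN; rewrite opprB.
Qed.
Fact tensor_equiv_trans : transitive tensor_equiv.
Proof.
move=> y x z /asboolP xy /asboolP yz; apply/asboolP.
by rewrite -[x](subrK y) -addrA; apply: TensorRelD.
Qed.

Canonical tensor_equivRel :=
  EquivRel tensor_equiv tensor_equiv_refl tensor_equiv_sym tensor_equiv_trans.

Definition tensor := {eq_quot tensor_equivRel}.

HB.instance Definition _ := Choice.on tensor.
HB.instance Definition _ := Quotient.on tensor.
HB.instance Definition _ : EqQuotient free tensor_equivRel tensor :=
  EqQuotient.on tensor.

Definition tensor_add := lift_op2 tensor +%R.
Definition tensor_opp := lift_op1 tensor -%R.
Definition tensor_scale (a : F) := lift_op1 tensor (fun x : free => a *: x).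
Definition tensor_zero : tensor := lift_cst tensor (0 : free).

Let eqtP (x y : free) : tensor_rel (x - y) -> \pi_tensor x = \pi_tensor y.
Proof. by move=> xy; apply/eqmodP/asboolP. Qed.
Let reprtP (x : free) : tensor_rel (repr (\pi_tensor x) - x).
Proof. by apply/asboolP; have /eqmodP := reprK (\pi_tensor x). Qed.

Let pi_add x y : tensor_add (\pi_tensor x) (\pi_tensor y) = \pi_tensor (x + y).
Proof.
unlock tensor_add; apply: eqtP.
by rewrite opprD addrACA; apply: TensorRelD; apply: reprtP.
Qed.
Let pi_opp x : tensor_opp (\pi_tensor x) = \pi_tensor (- x).
Proof. by unlock tensor_opp; apply: eqtP; rewrite -opprD; apply/tensor_relN/reprtP. Qed.
Let pi_scale a x : tensor_scale a (\pi_tensor x) = \pi_tensor (a *: x).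
Proof. by unlock tensor_scale; apply: eqtP; rewrite -scalerBr; apply/TensorRelZ/reprtP. Qed.
Let pi_zero : tensor_zero = \pi_tensor 0.
Proof. by unlock tensor_zero. Qed.

Fact tensor_addA : associative tensor_add.
Proof.
by elim/quotW=> x; elim/quotW=> y; elim/quotW=> z; rewrite !pi_add addrA.
Qed.
Fact tensor_addC : commutative tensor_add.
Proof. by elim/quotW=> x; elim/quotW=> y; rewrite !pi_add addrC. Qed.
Fact tensor_add0 : left_id tensor_zero tensor_add.
Proof. by elim/quotW=> x; rewrite pi_zero pi_add add0r. Qed.
Fact tensor_addN : left_inverse tensor_zero tensor_opp tensor_add.
Proof. by elim/quotW=> x; rewrite pi_opp pi_zero pi_add addNr. Qed.

HB.instance Definition _ :=
  GRing.isZmodule.Build tensor tensor_addA tensor_addC tensor_add0 tensor_addN.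

Fact tensor_scaleA a b x :
  tensor_scale a (tensor_scale b x) = tensor_scale (a * b) x.
Proof. by elim/quotW: x => x; rewrite !pi_scale scalerA. Qed.
Fact tensor_scale1 : left_id 1 tensor_scale.
Proof. by elim/quotW => x; rewrite pi_scale scale1r. Qed.
Fact tensor_scaleDr : right_distributive tensor_scale +%R.
Proof.
move=> a; elim/quotW=> x; elim/quotW=> y.
by rewrite /+%R /= pi_add !pi_scale pi_add scalerDr.
Qed.
Fact tensor_scaleDl x : {morph tensor_scale^~ x : a b / a + b}.
Proof.
move=> a b; elim/quotW: x => x.
by rewrite [in RHS]/+%R /= !pi_scale pi_add scalerDl.
Qed.

HB.instance Definition _ := GRing.Zmodule_isLmodule.Build F tensor
  tensor_scaleA tensor_scale1 tensor_scaleDr tensor_scaleDl.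

Fact pi_tensorP a (x y : free) :
  \pi_tensor (a *: x + y) = a *: \pi_tensor x + \pi_tensor y :> tensor.
Proof. by rewrite /+%R /*:%R /= pi_scale pi_add. Qed.

Definition pure (u : U) (v : V) : tensor := \pi_tensor (gen u v).

Fact pure_bilinear : bilinear_for *:%R *:%R pure.
Proof.
split=> [v a u u' | u a v v']; rewrite /pure -pi_tensorP; apply: eqtP.
  rewrite opprD addrA.
  have -> : gen (a *: u + u') v - a *: gen u v - gen u' v =
    (gen (a *: u + u') v - gen (a *: u) v - gen u' v)
    + (gen (a *: u) v - a *: gen u v).
    by rewrite addrAC -[RHS]addrAC addrA subrK addrAC.
  exact: TensorRelD (TensorRelDl _ _ _) (TensorRelZl _ _ _).
rewrite opprD addrA.
have -> : gen u (a *: v + v') - a *: gen u v - gen u v' =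
  (gen u (a *: v + v') - gen u (a *: v) - gen u v')
  + (gen u (a *: v) - a *: gen u v).
  by rewrite addrAC -[RHS]addrAC addrA subrK addrAC.
exact: TensorRelD (TensorRelDr _ _ _) (TensorRelZr _ _ _).
Qed.

HB.instance Definition _ :=
  bilinear_isBilinear.Build F U V tensor *:%R *:%R pure pure_bilinear.

Section Lift.
Variables (W : lmodType F) (b : {bilinear U -> V -> W}).

Let blift (x : free) : W := fglift (fun p : U * V => b p.1 p.2) x.

Let bliftB x y : blift (x - y) = blift x - blift y.
Proof. exact: lift_is_additive. Qed.
Let blift0 : blift 0 = 0.
Proof. by rewrite -(subrr 0) bliftB subrr. Qed.
Let bliftD x y : blift (x + y) = blift x + blift y.
Proof.
have bliftN z : blift (- z) = - blift z by rewrite -sub0r bliftB blift0 sub0r.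
by rewrite -{1}[y]opprK bliftB bliftN opprK.
Qed.
Let blift_sum I (r : seq I) (f : I -> free) :
  blift (\sum_(i <- r) f i) = \sum_(i <- r) blift (f i).
Proof. exact: (big_morph blift bliftD blift0). Qed.
Let bliftZ a x : blift (a *: x) = a *: blift x.
Proof.
rewrite -[x in RHS]freeg_sumE {1}/GRing.scale /= /fgscale !blift_sum scaler_sumr.
by apply: eq_bigr => p _; rewrite /blift !liftU scalerA.
Qed.
Let blift_gen u v : blift (gen u v) = b u v.
Proof. by rewrite /blift liftU scale1r. Qed.

Let blift_rel x : tensor_rel x -> blift x = 0.
Proof.
elim=> {x} [|x y _ x0 _ y0|a x _ x0|u u' v|u v v'|a u v|a u v].
- exact: blift0.
- by rewrite bliftD x0 y0 addr0.
- by rewrite bliftZ x0 scaler0.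
- by rewrite !bliftB !blift_gen linearDl addrAC addrK subrr.
- by rewrite !bliftB !blift_gen linearDr addrAC addrK subrr.
- by rewrite bliftB bliftZ !blift_gen linearZl_LR subrr.
- by rewrite bliftB bliftZ !blift_gen linearZr_LR subrr.
Qed.

Definition tlift_fun (x : tensor) : W := blift (repr x).

Let tlift_pi x : tlift_fun (\pi_tensor x) = blift x.
Proof. by apply/eqP; rewrite -subr_eq0 -bliftB blift_rel. Qed.

Fact tlift_fun_linear : linear tlift_fun.
Proof.
move=> a; elim/quotW=> x; elim/quotW=> y.
by rewrite -pi_tensorP !tlift_pi bliftD bliftZ.
Qed.

HB.instance Definition _ := GRing.isLinear.Build F tensor W *:%R tlift_fun
  tlift_fun_linear.

Definition tlift : {linear tensor -> W} := tlift_fun.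

Lemma tlift_pure u v : tlift (pure u v) = b u v.
Proof. by rewrite /= tlift_pi blift_gen. Qed.

End Lift.

Lemma tensor_ext (W : lmodType F) (f g : {linear tensor -> W}) :
  (forall u v, f (pure u v) = g (pure u v)) -> f = g.
Proof.
move=> fg; apply: linear_eqP; elim/quotW=> x; rewrite -[x]freeg_sumE.
pose P (y : free) := f (\pi_tensor y) = g (\pi_tensor y).
have P0 : P 0 by rewrite /P -pi_zero -[tensor_zero]/(0 : tensor) !raddf0.
have PP a y z : P y -> P z -> P (a *: y + z).
  by rewrite /P pi_tensorP !linearP => -> ->.
apply: (big_ind P) => // [y z Py Pz|p _].
  by rewrite -[y]scale1r; apply: PP.
have -> : [freeg [:: (coeff p x, p)]] = coeff p x *: gen p.1 p.2 + 0.
  apply/eqP/freeg_eqP => q; rewrite addr0 coeffZ !coeffU mul1r.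
  by case: p.
by apply: PP; [apply: fg|].
Qed.

End Tensor.

Notation "U \ox V" := (tensor U V) (at level 40, left associativity) :
  type_scope.

Section TensorMaps.
Variable F : fieldType.

Section Map.
Variables (U V U' V' : lmodType F).
Variables (f : {linear U -> U'}) (g : {linear V -> V'}).

Definition tmap_fun (u : U) (v : V) : U' \ox V' := pure (f u) (g v).
Fact tmap_bilinear : bilinear_for *:%R *:%R tmap_fun.
Proof.
by split=> [v a u u'|u a v v']; rewrite /tmap_fun linearP ?linearPl ?linearPr.
Qed.
HB.instance Definition _ :=
  bilinear_isBilinear.Build F U V (U' \ox V') *:%R *:%R tmap_fun tmap_bilinear.

Definition tmap : {linear U \ox V -> U' \ox V'} := tlift tmap_fun.

Lemma tmapE u v : tmap (pure u v) = pure (f u) (g v).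
Proof. exact: tlift_pure. Qed.
End Map.

Section Assoc.
Variables (U V W : lmodType F).

Section Inner.
Variable w : W.
Definition tassoc_in (u : U) (v : V) : U \ox (V \ox W) := pure u (pure v w).
Fact tassoc_in_bilinear : bilinear_for *:%R *:%R tassoc_in.
Proof.
split=> [v a u u'|u a v v']; rewrite /tassoc_in; first by rewrite linearPl.
by rewrite linearPl linearPr.
Qed.
HB.instance Definition _ := bilinear_isBilinear.Build F U V
  (U \ox (V \ox W)) *:%R *:%R tassoc_in tassoc_in_bilinear.
End Inner.

Definition tassoc_fun (x : U \ox V) (w : W) : U \ox (V \ox W) :=
  tlift (tassoc_in w) x.
Fact tassoc_bilinear : bilinear_for *:%R *:%R tassoc_fun.
Proof.
split=> [w a x x'|x a w w']; rewrite /tassoc_fun; first by rewrite linearP.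
suff -> : tlift (tassoc_in (a *: w + w')) =
          a *: tlift (tassoc_in w) + tlift (tassoc_in w') by [].
apply: tensor_ext => u v.
transitivity (a *: tlift (tassoc_in w) (pure u v)
              + tlift (tassoc_in w') (pure u v)); last by [].
by rewrite !tlift_pure /= /tassoc_in !linearPr.
Qed.
HB.instance Definition _ := bilinear_isBilinear.Build F (U \ox V) W
  (U \ox (V \ox W)) *:%R *:%R tassoc_fun tassoc_bilinear.

Definition tassoc : {linear (U \ox V) \ox W -> U \ox (V \ox W)} :=
  tlift tassoc_fun.

Lemma tassocE u v w : tassoc (pure (pure u v) w) = pure u (pure v w).
Proof. by rewrite [LHS]tlift_pure [LHS]tlift_pure. Qed.

End Assoc.

Section Unit.
Variable U : lmodType F.

Definition tunitl_fun (a : F^o) (u : U) : U := (a : F) *: u.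
Fact tunitl_bilinear : bilinear_for *:%R *:%R tunitl_fun.
Proof.
split=> [u a x y|x a u v]; rewrite /= /tunitl_fun.
  by rewrite scalerDl -[a *: x]/((a : F) * x) scalerA.
by rewrite scalerDr !scalerA mulrC.
Qed.
HB.instance Definition _ := bilinear_isBilinear.Build F F^o U U
  *:%R *:%R tunitl_fun tunitl_bilinear.
Definition tunitl : {linear F^o \ox U -> U} := tlift tunitl_fun.

Lemma tunitlE a u : tunitl (pure a u) = (a : F) *: u.
Proof. exact: tlift_pure. Qed.

Definition tunitr_fun (u : U) (a : F^o) : U := (a : F) *: u.
Fact tunitr_bilinear : bilinear_for *:%R *:%R tunitr_fun.
Proof. by split=> [a b u v|u b x y]; [exact: tunitl_bilinear.2|exact: tunitl_bilinear.1]. Qed.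
HB.instance Definition _ := bilinear_isBilinear.Build F U F^o U
  *:%R *:%R tunitr_fun tunitr_bilinear.
Definition tunitr : {linear U \ox F^o -> U} := tlift tunitr_fun.

Lemma tunitrE u a : tunitr (pure u a) = (a : F) *: u.
Proof. exact: tlift_pure. Qed.
End Unit.

End TensorMaps.

Notation "f \oxL g" := (tmap f g) (at level 40, left associativity).

Section TensorPowers.
Variables (F : fieldType) (C : lmodType F).

(* Right-nested: C^{(x)0} = F, C^{(x)1} = C and                               *)
(* C^{(x)(n+2)} = C (x) C^{(x)(n+1)}, so that tpow 1 is C and tpow 2 is       *)
(* C \ox C by computation.                                                    *)
Fixpoint tpow (n : nat) : lmodType F :=
  match n with
  | 0 => F^o
  | n'.+1 => match n' with 0 => C | _ => C \ox tpow n' end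
  end.

(* The canonical isomorphisms C (x) C^{(x)n} = C^{(x)(n+1)} and               *)
(* C^{(x)n} (x) C = C^{(x)(n+1)}.                                             *)
Definition tcons n : {linear C \ox tpow n -> tpow n.+1} :=
  match n with 0 => tunitr C | _.+1 => lid _ end.

Fixpoint tsnoc n : {linear tpow n \ox C -> tpow n.+1} :=
  match n with
  | 0 => tunitl C
  | n'.+1 =>
    match n' return {linear tpow n' \ox C -> tpow n'.+1} ->
                    {linear tpow n'.+1 \ox C -> tpow n'.+2} with
    | 0 => fun=> lid _
    | k.+1 => fun s => (lid C \oxL s) \oL tassoc C (tpow k.+1) C
    end (tsnoc n')
  end.

(* slot1 f n i and slot2 D n i are Id^{(x)i} (x) f (x) Id^{(x)(n-i-1)} and    *)
(* Id^{(x)i} (x) D (x) Id^{(x)(n-i-1)}; the positions i < n are counted from  *)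
(* 0, and the values at i >= n are irrelevant.                                *)
Fixpoint slot1 (f : {linear C -> C}) n : nat -> {linear tpow n -> tpow n} :=
  match n with
  | 0 => fun=> 0
  | n'.+1 =>
    match n' return (nat -> {linear tpow n' -> tpow n'}) ->
                    nat -> {linear tpow n'.+1 -> tpow n'.+1} with
    | 0 => fun _ _ => f
    | k.+1 => fun s i =>
      if i is j.+1 then lid C \oxL s j else f \oxL lid (tpow k.+1)
    end (slot1 f n')
  end.

Fixpoint slot2 (D : {linear C -> C \ox C}) n :
    nat -> {linear tpow n -> tpow n.+1} :=
  match n with
  | 0 => fun=> 0
  | n'.+1 =>
    match n' return (nat -> {linear tpow n' -> tpow n'.+1}) ->
                    nat -> {linear tpow n'.+1 -> tpow n'.+2} with
    | 0 => fun _ _ => D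
    | k.+1 => fun s i =>
      if i is j.+1 then lid C \oxL s j
      else tassoc C C (tpow k.+1) \oL (D \oxL lid (tpow k.+1))
    end (slot2 D n')
  end.

End TensorPowers.

Structure coalgebra (F : fieldType) := Coalgebra {
  coalg_space :> lmodType F;
  comul : {linear coalg_space -> coalg_space \ox coalg_space};
  comulA : (lid coalg_space \oxL comul) \oL comul =
           tassoc _ _ _ \oL (comul \oxL lid coalg_space) \oL comul
}.
Arguments comul {F} c.

Definition coderivation (F : fieldType) (C : coalgebra F)
    (psi : {linear C -> C}) : Prop :=
  comul C \oL psi =
  (psi \oxL lid C) \oL comul C + (lid C \oxL psi) \oL comul C.

Structure coder_pair (F : fieldType) := CoderPair {
  coder_coalg :> coalgebra F;
  coder : {linear coder_coalg -> coder_coalg};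
  coderP : coderivation coder
}.
Arguments coder {F} c.

Section Cohomology.
Variables (F : fieldType) (P : coder_pair F).

Definition delta_c n (f : {linear P -> tpow P n}) : {linear P -> tpow P n.+1} :=
  tcons P n \oL (lid P \oxL f) \oL comul P
  + \sum_(i < n) (-1) ^+ i.+1 *: (slot2 (comul P) n i \oL f)
  + (-1) ^+ n.+1 *: (tsnoc P n \oL (f \oxL lid P) \oL comul P).

Definition omega n (f : {linear P -> tpow P n}) : {linear P -> tpow P n} :=
  \sum_(i < n) slot1 (coder P) n i \oL f - f \oL coder P.

(* 'rV[F]_0 is the zero space. *)
Definition coder_cochain (n : nat) : lmodType F :=
  match n with
  | 0 => 'rV[F]_0
  | n'.+1 =>
    match n' with
    | 0 => {linear P -> P}
    | _ => ({linear P -> tpow P n'.+1} * {linear P -> tpow P n'})%type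
    end
  end.

Definition coder_diff n : coder_cochain n -> coder_cochain n.+1 :=
  match n return coder_cochain n -> coder_cochain n.+1 with
  | 0 => fun=> 0
  | 1 => fun f => (delta_c (n := 1) f, - omega (n := 1) f)
  | k.+2 => fun fg =>
    (delta_c (n := k.+2) fg.1,
     delta_c (n := k.+1) fg.2 + (-1) ^+ k.+2 *: omega (n := k.+2) fg.1)
  end.

Definition coder_cocycle n (x : coder_cochain n) : Prop := coder_diff x = 0.

End Cohomology.

(* Formal power series of linear maps are given by their coefficients;        *)
(* series_comp is the t-linear composition (Cauchy product).                  *)
Definition series_comp (F : fieldType) (U V W : lmodType F)
    (g : nat -> {linear V -> W}) (f : nat -> {linear U -> V}) (k : nat) :
    {linear U -> W} :=
  \sum_(i < k.+1) g i \oL f (k - i)%N.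

Section Deformation.
Variables (F : fieldType) (P : coder_pair F).
Variables (Delta : nat -> {linear P -> P \ox P}) (psi : nat -> {linear P -> P}).

Structure formal_deformation : Prop := FormalDeformation {
  deform_comul0 : Delta 0%N = comul P;
  deform_coder0 : psi 0%N = coder P;
  deform_comulA : forall k,
    series_comp (fun i => lid P \oxL Delta i) Delta k =
    series_comp (fun i => tassoc _ _ _ \oL (Delta i \oxL lid P)) Delta k;
  deform_coderP : forall k,
    series_comp Delta psi k =
    series_comp (fun i => psi i \oxL lid P) Delta k
    + series_comp (fun i => lid P \oxL psi i) Delta k
}.

End Deformation.

(* Main.v *)
(** In degree n the deformation equations are Cauchy products. When the terms
    of index strictly between 0 and n vanish, only the two extreme summands
    survive, and the equations become the two components of the 2-cocycle
    condition on the terms of index n. *)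
Require Import Defs.
From mathcomp Require Import all_boot all_algebra.

Set Implicit Arguments.
Unset Strict Implicit.
Unset Printing Implicit Defensive.

Import GRing.Theory.
Local Open Scope ring_scope.

Section LinearMapAlgebra.
Variables (F : fieldType) (U V W : lmodType F).

Lemma lcomp0r (g : {linear V -> W}) : g \oL (0 : {linear U -> V}) = 0.
Proof. by apply: linear_eqP => x; apply: linear0. Qed.

Lemma lcomp_idl (f : {linear U -> V}) : lid V \oL f = f.
Proof. exact: linear_eqP. Qed.

Lemma tmap_id : lid U \oxL lid V = lid (U \ox V).
Proof. by apply: tensor_ext => u v; rewrite tmapE. Qed.

End LinearMapAlgebra.

(** The vanishing is asked of the right factor: in each use [f] is [Delta] or [psi] itself, while
    [g] is mostly a tensor with the identity. *)
Lemma series_comp_extreme (F : fieldType) (U V W : lmodType F)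
    (g : nat -> {linear V -> W}) (f : nat -> {linear U -> V}) (n : nat) :
  (0 < n)%N -> (forall i, (0 < i < n)%N -> f i = 0) ->
  series_comp g f n = g 0%N \oL f n + g n \oL f 0%N.
Proof.
case: n => // n _ f0; rewrite /series_comp big_ord_recl big_ord_recr /=.
rewrite big1 ?add0r ?subn0 ?subnn // => i _.
(* The middle summand [i < n] has left index [i.+1], hence right index [n - i], which lies in
   [[1, n]]. *)
rewrite f0 ?lcomp0r //= /bump /= add1n subSS subn_gt0 ltn_ord.
by rewrite ltnS leq_subr.
Qed.

Lemma deformation_cocycle (F : fieldType) (P : coder_pair F)
    (Delta : nat -> {linear P -> P \ox P}) (psi : nat -> {linear P -> P})
    (n : nat) :
  formal_deformation Delta psi -> (0 < n)%N ->
  (forall i, (0 < i < n)%N -> (Delta i, psi i) = 0) ->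
  coder_cocycle (P := P) (n := 2) (Delta n, psi n).
Proof.
move=> [Delta0 psi0 coassoc coder_eq] n_gt0 low0.
have Deltalow i : (0 < i < n)%N -> Delta i = 0 by move=> /low0[].
have psilow i : (0 < i < n)%N -> psi i = 0 by move=> /low0[].
have := coassoc n; have := coder_eq n.
rewrite !series_comp_extreme // Delta0 psi0 => coder_n coassoc_n.
rewrite /coder_cocycle /coder_diff; congr pair.
(* In degree 2, [tsnoc] is [tassoc] followed by a tensor of identities, which [tmap_id] removes. *)
- rewrite /delta_c !big_ord_recl big_ord0 /= !lcomp_idl tmap_id lcomp_idl.
  rewrite expr1 !exprS expr0 !mulr1 !mulrNN !mulr1 !scaleN1r scale1r addr0.
  by rewrite addrCA [_ + lid P \oxL comul P \oL _]addrC coassoc_n addKr subrr.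
- rewrite /delta_c /omega !big_ord_recl !big_ord0 /= !lcomp_idl !addr0.
  rewrite sqrrN expr1n !scale1r expr1 scaleN1r.
  (* The two negative terms, one from [delta_c], one from [omega], form the left side of [coder_n];
     the four positive ones match its right side up to order. *)
  rewrite addrAC addrACA -opprD coder_n addrAC [X in _ - X]addrACA.
  rewrite -[X in X - _]addrA [X in X - _]addrCA.
  by rewrite (addrC (lid P \oxL psi n \oL _)) subrr.
Qed.

Theorem proposition4p1 (F : fieldType) (charF0 : [pchar F] =i pred0)
    (P : coder_pair F)
    (Delta : nat -> {linear P -> P \ox P}) (psi : nat -> {linear P -> P})
    (deformP : formal_deformation Delta psi) :
  coder_cocycle (P := P) (n := 2) (Delta 1%N, psi 1%N) /\
  (forall m : nat, (1 <= m)%N ->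
     (forall i : nat, (1 <= i <= m)%N -> (Delta i, psi i) = 0) ->
     coder_cocycle (P := P) (n := 2) (Delta m.+1, psi m.+1)).
Proof.
split=> [|m _ low0]; apply: deformation_cocycle => // i.
(* Only the first claim is left, where the range [0 < i < 1] is empty. *)
by rewrite ltnS andbC; case: i.
Qed.
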